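(* Let $K$ be a compact Hausdorff topological space. A regular Borel signed measure $\mu$ on $K$ is an extreme point of the unit ball of $(\mathcal{M}(K),\|\cdot\|_0)$ if and only if it is one of the following: (a) $\mu=\pm\delta_t$, where $t\in K$; (b) $\mu=\delta_s-\delta_t$, where $s,t$ are distinct points in $K$.
   Context: $\mathcal{M}(K)$ is the space of regular Borel signed measures on $K$; $\mu^+,\mu^-$ are the positive and negative parts of $\mu$; $\|\mu\|_1=|\mu|(K)$; and $\|\mu\|_0=\max\{\|\mu^+\|_1,\|\mu^-\|_1\}$. $\delta_t$ is the unit point mass at $t$. *)

(* Defs.v *)
From HB Require Import structures.
From mathcomp Require Import all_boot all_order all_algebra.
From mathcomp Require Import all_classical all_reals all_analysis.

Set Implicit Arguments.
Unset Strict Implicit.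
Unset Printing Implicit Defensive.

Import Order.TTheory GRing.Theory Num.Theory.
Import numFieldNormedType.Exports.

Local Open Scope classical_set_scope.
Local Open Scope ring_scope.

Notation borelType K := (g_sigma_algebraType (@open K)).

(* A charge is finite-valued on measurable sets, hence a signed measure. *)
Notation signed_measure K R := (charge (borelType K) R).

(* A charge also takes (meaningless) values on non-measurable sets, so signed
   measures are identified when they agree on the measurable ones. *)
Definition charge_eq (d : measure_display) (T : measurableType d)
    (R : realType) (mu nu : {charge set T -> \bar R}) : Prop :=
  forall A, measurable A -> mu A = nu A.

Lemma hahn_pair_ex (d : measure_display) (T : measurableType d)
    (R : realType) (mu : {charge set T -> \bar R}) :
  exists PN : set T * set T, hahn_decomposition mu PN.1 PN.2.
Proof. by have [P [N muPN]] := Hahn_decomposition mu; exists (P, N). Qed.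

(* A chosen Hahn decomposition; by [Hahn_decomposition_uniq] the measures
   below do not depend on the choice. *)
Definition hahn_pair (d : measure_display) (T : measurableType d)
    (R : realType) (mu : {charge set T -> \bar R}) : set T * set T :=
  sval (cid (hahn_pair_ex mu)).

Lemma hahn_pairP (d : measure_display) (T : measurableType d)
    (R : realType) (mu : {charge set T -> \bar R}) :
  hahn_decomposition mu (hahn_pair mu).1 (hahn_pair mu).2.
Proof. exact: svalP (cid (hahn_pair_ex mu)). Qed.

Definition pos_part (d : measure_display) (T : measurableType d)
    (R : realType) (mu : {charge set T -> \bar R}) :
    {charge set T -> \bar R} :=
  charge_of_finite_measure (jordan_pos (hahn_pairP mu)).

Definition neg_part (d : measure_display) (T : measurableType d)
    (R : realType) (mu : {charge set T -> \bar R}) :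
    {charge set T -> \bar R} :=
  charge_of_finite_measure (jordan_neg (hahn_pairP mu)).

Definition abs_charge (d : measure_display) (T : measurableType d)
    (R : realType) (mu : {charge set T -> \bar R}) :
    {measure set T -> \bar R} :=
  charge_variation (hahn_pairP mu).

Definition norm1 (d : measure_display) (T : measurableType d)
    (R : realType) (mu : {charge set T -> \bar R}) : \bar R :=
  abs_charge mu [set: T].

Definition norm0 (d : measure_display) (T : measurableType d)
    (R : realType) (mu : {charge set T -> \bar R}) : \bar R :=
  maxe (norm1 (pos_part mu)) (norm1 (neg_part mu)).

(* Compact inner regularity at every Borel set, not only at open ones. *)
Definition regular_measure (K : ptopologicalType) (R : realType)
    (mu : {measure set (borelType K) -> \bar R}) : Prop :=
  forall A : set (borelType K), measurable A ->
    mu A = ereal_inf [set mu U | U in [set U : set K | open U /\ A `<=` U]] /\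
    mu A = ereal_sup [set mu C | C in [set C : set K | compact C /\ C `<=` A]].

Definition regular_charge (K : ptopologicalType) (R : realType)
    (mu : signed_measure K R) : Prop :=
  regular_measure (abs_charge mu).

(* Closed unit ball, for norm0, of the space of regular signed measures. *)
Definition unit_ball0 (K : ptopologicalType) (R : realType) :
    set (signed_measure K R) :=
  [set mu | regular_charge mu /\ (norm0 mu <= 1)%E].

Definition extreme_point (d : measure_display) (T : measurableType d)
    (R : realType) (B : set (charge T R))
    (mu : {charge set T -> \bar R}) : Prop :=
  B mu /\
  forall (nu1 nu2 : {charge set T -> \bar R}) (r : R),
    B nu1 -> B nu2 -> 0 < r < 1 ->
    charge_eq mu (cadd (cscale r nu1) (cscale (1 - r) nu2)) ->
    charge_eq nu1 mu /\ charge_eq nu2 mu.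

Definition delta (K : ptopologicalType) (R : realType) (t : K) :
    signed_measure K R :=
  charge_of_finite_measure (dirac (t : borelType K)).

(* Main.v *)
Require Import Defs.
From HB Require Import structures.
From mathcomp Require Import all_boot all_order all_algebra.
From mathcomp Require Import all_classical all_reals all_analysis.
From mathcomp Require Import lra.

Set Implicit Arguments.
Unset Strict Implicit.
Unset Printing Implicit Defensive.

Import Order.TTheory GRing.Theory Num.Theory.
Import numFieldNormedType.Exports.

Local Open Scope classical_set_scope.
Local Open Scope ring_scope.

(** The unit ball of [norm0] consists of the regular signed measures with
    [-1 <= mu A <= 1] for every Borel set [A] ([norm0_le1P]), because the two
    Jordan parts have masses [mu P] and [- mu N] for a Hahn decomposition
    [(P, N)].  All that follows is done with these real values.

    From the values to extremality.  If [mu = r nu1 + (1 - r) nu2] in the ball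
    and [mu {s} = 1], then both [nu_i {s}] are 1, the largest possible value,
    and then [nu_i] cannot be positive on any Borel set missing [s]
    ([full_atom_le0]).  For [mu = delta_s] the two masses of such a set are
    therefore nonpositive numbers with zero convex combination, so they vanish.
    For [mu = delta_s - delta_t] the atom of value -1 at [t] supplies the
    opposite inequality, and each [nu_i] is determined.

    From extremality to the values.  If [mu + h] and [mu - h] both lie in the
    ball then [h = 0] ([extreme_perturbation]); [h] is regular as soon as it is
    dominated by a multiple of [|mu|].  Using [h = (1 - p) mu] on [P], where
    [p = mu P], gives [p = 0] or [p = 1].  For a Borel set [A] contained in [P],
    using [h = b mu] on [A] and [h = - a mu] on [P \ A], where [a = mu A] and
    [b = mu (P \ A)], leaves the mass of [P] unchanged and gives [a b = 0].  So the positive part of [mu] is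
    zero or takes only the values 0 and 1, and in the latter case regularity
    and a compactness argument make it a Dirac measure ([zero_one_dirac]).
    The same applied to [- mu], whose Hahn decomposition is [(N, P)], describes
    the negative part.  The two points are distinct because they lie in [P]
    and in [N], and both parts cannot vanish since 0 is the midpoint of
    [delta_t] and [- delta_t]. *)

(** * Real values and total variation of a charge *)

Section charge_values.
Context (d : measure_display) (T : measurableType d) (R : realType).
Implicit Types (mu nu h : {charge set T -> \bar R}) (A B P N : set T).

Definition cval mu A : R := fine (mu A).

Definition tvar mu A : R := fine (abs_charge mu A).

Lemma cvalE mu A : measurable A -> mu A = (cval mu A)%:E.
Proof. by move=> mA; rewrite /cval fineK// fin_num_measure. Qed.

Lemma charge_eqP mu nu :
  charge_eq mu nu <-> forall A, measurable A -> cval mu A = cval nu A.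
Proof.
split=> [e A mA|e A mA]; first by rewrite /cval e.
by rewrite !cvalE// e.
Qed.

Lemma cval0 mu : cval mu set0 = 0.
Proof. by rewrite /cval charge0. Qed.

Lemma cvalDI mu A B : measurable A -> measurable B ->
  cval mu A = cval mu (A `&` B) + cval mu (A `\` B).
Proof.
move=> mA mB; rewrite /cval (chargeDI mu mA mB) fineD ?fin_num_measure//.
- by rewrite addrC.
- exact: measurableD.
- exact: measurableI.
Qed.

Lemma cvalU mu A B : measurable A -> measurable B -> A `&` B = set0 ->
  cval mu (A `|` B) = cval mu A + cval mu B.
Proof. by move=> mA mB AB; rewrite /cval chargeU// fineD ?fin_num_measure. Qed.

(** The way to compare two charges that have an atom at [s]: their values at the
    atom and on the sets missing [s] suffice. *)
Lemma cval_split1 mu (s : T) A : measurable [set s] -> measurable A ->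
  cval mu A = \1_A s * cval mu [set s] + cval mu (A `\ s).
Proof.
move=> ms mA; rewrite (cvalDI mu mA ms); congr (_ + _).
rewrite indicE; have [As|nAs] := pselect (A s).
  by rewrite mem_set// mul1r; congr cval; apply/setIidr => _ ->.
rewrite memNset// mul0r -(cval0 mu); congr cval.
by apply/disjoints_subset => x Ax /= xs; apply: nAs; rewrite -xs.
Qed.

Lemma cval_add mu nu A : measurable A ->
  cval (cadd mu nu) A = cval mu A + cval nu A.
Proof. by move=> mA; rewrite /cval/= /cadd fineD ?fin_num_measure. Qed.

Lemma cval_scale r mu A : measurable A -> cval (cscale r mu) A = r * cval mu A.
Proof. by move=> mA; rewrite /cval/= /cscale fineM ?fin_num_measure. Qed.

Lemma cval_opp mu A : cval (copp mu) A = - cval mu A.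
Proof. by rewrite /cval/= /copp fineN. Qed.

Lemma cval_restr mu (D : set T) (mD : measurable D) A :
  cval (crestr mu mD) A = cval mu (A `&` D).
Proof. by []. Qed.

Lemma cval_pos mu P N : hahn_decomposition mu P N ->
  forall A, measurable A -> A `<=` P -> 0 <= cval mu A.
Proof. by move=> [[_ posP] _ _ _] A mA AP; apply/fine_ge0/posP. Qed.

Lemma hahn_opp mu P N :
  hahn_decomposition mu P N -> hahn_decomposition (copp mu) N P.
Proof.
move=> [[mP hP] [mN hN] PN PN0]; split; last 2 first.
- by rewrite setUC.
- by rewrite setIC.
- by split=> // A mA AN; rewrite /= /copp oppe_ge0 hN.
- by split=> // A mA AP; rewrite /= /copp oppe_le0 hP.
Qed.

Lemma cval_neg mu P N : hahn_decomposition mu P N ->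
  forall A, measurable A -> A `<=` N -> cval mu A <= 0.
Proof.
by move=> /hahn_opp h A mA AN; rewrite -oppr_ge0 -cval_opp; exact: (cval_pos h).
Qed.

Lemma cval_hahn mu P N A : hahn_decomposition mu P N -> measurable A ->
  cval mu A = cval mu (A `&` P) + cval mu (A `&` N).
Proof.
move=> [[mP _] [mN _] PN PN0] mA.
rewrite /cval (charge_partition mu mA mP mN PN PN0) fineD// fin_num_measure//.
- exact: measurableI.
- exact: measurableI.
Qed.

(** The variation may be computed with any Hahn decomposition, not only with the
    chosen one. *)
Lemma tvarE mu P N A : hahn_decomposition mu P N -> measurable A ->
  tvar mu A = cval mu (A `&` P) - cval mu (A `&` N).
Proof.
move=> h mA; have [eP eN] := Hahn_decomposition_uniq h (hahn_pairP mu) mA.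
rewrite /tvar /abs_charge /= /charge_variation jordan_posE jordan_negE.
rewrite cjordan_posE cjordan_negE /crestr0 mem_set// /crestr -eP -eN.
have [[mP _] [mN _] _ _] := h.
rewrite fineD ?fin_numN ?fin_num_measure//; [|exact: measurableI..].
by rewrite fineN.
Qed.

Lemma abs_chargeE mu A : measurable A -> abs_charge mu A = (tvar mu A)%:E.
Proof.
move=> mA; rewrite /tvar fineK// /abs_charge.
exact: (fin_num_measure (charge_variation (hahn_pairP mu))).
Qed.

Lemma cval_le_tvar mu A : measurable A -> `|cval mu A| <= tvar mu A.
Proof.
move=> mA; have h := hahn_pairP mu; have [[mP _] [mN _] _ _] := h.
rewrite (tvarE h mA) (cval_hahn h mA) (le_trans (ler_normD _ _))//.
rewrite ger0_norm ?ler0_norm//.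
- by apply: (cval_neg h); [exact: measurableI|exact: subIsetr].
- by apply: (cval_pos h); [exact: measurableI|exact: subIsetr].
Qed.

Lemma cval_pos_le_tvar mu P N A : hahn_decomposition mu P N -> measurable A ->
  cval mu (A `&` P) <= tvar mu A.
Proof.
move=> h mA; have [_ [mN _] _ _] := h; rewrite (tvarE h mA) lerDl oppr_ge0.
by apply: (cval_neg h); [exact: measurableI|exact: subIsetr].
Qed.

(** Domination passes from values to variations because [tvar nu A] is a
    difference of two values of [nu], on the two disjoint pieces of [A] cut out
    by a Hahn decomposition of [nu]. *)
Lemma tvar_dominated mu nu (c : R) :
  (forall B, measurable B -> `|cval nu B| <= c * tvar mu B) ->
  forall A, measurable A -> tvar nu A <= c * tvar mu A.
Proof.
move=> H A mA; have h := hahn_pairP nu; have [[mP _] [mN _] PN PN0] := h.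
have mAP : measurable (A `&` (hahn_pair nu).1) by exact: measurableI.
have mAN : measurable (A `&` (hahn_pair nu).2) by exact: measurableI.
rewrite (tvarE h mA).
have -> : tvar mu A = tvar mu (A `&` (hahn_pair nu).1) +
                      tvar mu (A `&` (hahn_pair nu).2).
  rewrite /tvar -fineD; last 2 first.
  - by rewrite abs_chargeE.
  - by rewrite abs_chargeE.
  rewrite -measureU//; first by rewrite -setIUr PN setIT.
  by rewrite setIACA PN0 setI0.
rewrite mulrDr lerD//.
- by rewrite (le_trans (ler_norm _))// H.
- by rewrite (le_trans _ (H _ mAN))// -normrN ler_norm.
Qed.

Lemma tvarDI mu A B : measurable A -> measurable B ->
  tvar mu A = tvar mu (A `&` B) + tvar mu (A `\` B).
Proof.
move=> mA mB; have mAB : measurable (A `&` B) by exact: measurableI.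
have mADB : measurable (A `\` B) by exact: measurableD.
rewrite /tvar -fineD ?abs_chargeE// -?abs_chargeE//.
by rewrite addeC -measureDI.
Qed.

(** A nonnegative charge has [(setT, set0)] as a Hahn decomposition. *)
Lemma norm1_nonneg mu : (forall A, (0 <= mu A)%E) -> norm1 mu = mu setT.
Proof.
move=> mu0; rewrite /norm1 abs_chargeE// (cvalE _ measurableT); congr _%:E.
rewrite (@tvarE mu setT set0) ?setIT ?setI0 ?cval0 ?subr0//.
split; rewrite ?setU0 ?setI0//; last exact: negative_set0.
Qed.

Lemma norm0E mu P N : hahn_decomposition mu P N ->
  norm0 mu = (Num.max (cval mu P) (- cval mu N))%:E.
Proof.
move=> h; have [eP eN] := Hahn_decomposition_uniq h (hahn_pairP mu) measurableT.
have [[mP _] [mN _] _ _] := h.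
rewrite /norm0 !norm1_nonneg/=; last 2 first.
- by move=> A; exact: (measure_ge0 (jordan_neg (hahn_pairP mu))).
- by move=> A; exact: (measure_ge0 (jordan_pos (hahn_pairP mu))).
rewrite /charge_of_finite_measure jordan_posE jordan_negE.
rewrite cjordan_posE cjordan_negE /crestr0 mem_set// /crestr -eP -eN !setTI.
by rewrite !cvalE// EFin_max.
Qed.

(** [mu P] and [mu N] are the largest and the smallest values of [mu], so
    bounding the two Jordan masses by 1 bounds all values. *)
Lemma norm0_le1P mu :
  (norm0 mu <= 1)%E <-> forall A, measurable A -> `|cval mu A| <= 1.
Proof.
have h := hahn_pairP mu; have [[mP _] [mN _] _ _] := h.
rewrite (norm0E h) lee_fin ge_max; split=> [/andP[hP hN] A mA|H]; last first.
  have := H _ mP; have := H _ mN; rewrite !ler_norml.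
  by move=> /andP[? ?] /andP[? ?]; apply/andP; split; lra.
have pD := cval_pos h (measurableD mP mA) (@subDsetl _ _ _).
have nD := cval_neg h (measurableD mN mA) (@subDsetl _ _ _).
have pI := cval_pos h (measurableI _ _ mA mP) (@subIsetr _ _ _).
have nI := cval_neg h (measurableI _ _ mA mN) (@subIsetr _ _ _).
have := cvalDI mu mP mA; have := cvalDI mu mN mA.
rewrite (cval_hahn h mA) ler_norml !(setIC _ A) => eN eP.
by apply/andP; split; lra.
Qed.

End charge_values.

(** * Regularity of Borel charges *)

Section regularity.
Context (R : realType) (K : ptopologicalType).
Hypothesis hK : hausdorff_space K.
Implicit Types (mu nu : signed_measure K R).

Lemma open_borel (U : set K) : open U -> measurable (U : set (borelType K)).
Proof. by move=> oU; apply: sub_sigma_algebra. Qed.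

Lemma closed_borel (C : set K) : closed C -> measurable (C : set (borelType K)).
Proof.
move=> cC; have mC := measurableC (open_borel (closed_openC cC)).
by rewrite setCK in mC.
Qed.

Lemma compact_borel (C : set K) : compact C -> measurable (C : set (borelType K)).
Proof. by move=> /(compact_closed hK); exact: closed_borel. Qed.

Lemma closed1 (s : K) : closed [set s].
Proof. exact/accessible_closed_set1/hausdorff_accessible. Qed.

Lemma borel1 (s : K) : measurable ([set s] : set (borelType K)).
Proof. exact: (closed_borel (@closed1 s)). Qed.

(** Since the variation is finite, approximation of its values can be stated as
    smallness of the difference sets; this form is stable under domination. *)
Lemma regular_chargeP mu :
  regular_charge mu <->
  forall (A : set (borelType K)) (e : R), measurable A -> 0 < e ->
    (exists2 U : set K, open U /\ A `<=` U & tvar mu (U `\` A) < e) /\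
    (exists2 C : set K, compact C /\ C `<=` A & tvar mu (A `\` C) < e).
Proof.
have le_mu (A B : set (borelType K)) : measurable A -> measurable B ->
    A `<=` B -> (abs_charge mu A <= abs_charge mu B)%E.
  by move=> mA mB; apply: le_measure; rewrite inE.
have diff (A B : set (borelType K)) : measurable A -> measurable B ->
    A `<=` B -> tvar mu B = tvar mu A + tvar mu (B `\` A).
  by move=> mA mB AB; rewrite (tvarDI mu mB mA) setIidr.
split=> [rmu A e mA e0|H A mA].
- have [infE supE] := rmu A mA; split.
  + have /ereal_inf_ltP[_ [U [oU AU] <-]] : (ereal_inf [set abs_charge mu U |
        U in [set U : set K | open U /\ A `<=` U]] < (tvar mu A + e)%:E)%E.
      by rewrite -infE abs_chargeE// lte_fin ltrDl.
    have mU := open_borel oU.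
    by rewrite abs_chargeE// lte_fin (diff _ _ mA mU AU) ltrD2l; exists U.
  + have /ereal_sup_gtP[_ [C [cC CA] <-]] : ((tvar mu A - e)%:E < ereal_sup
        [set abs_charge mu C | C in [set C : set K | compact C /\ C `<=` A]])%E.
      by rewrite -supE abs_chargeE// lte_fin ltrBlDr ltrDl.
    have mC := compact_borel cC.
    rewrite abs_chargeE// lte_fin (diff _ _ mC mA CA) => ?.
    by exists C => //; lra.
- split; apply/eqP; rewrite eq_le; apply/andP; split.
  + apply/ereal_infP => _ [U [oU AU] <-]; apply: le_mu => //.
    exact: open_borel.
  + apply/lee_addgt0Pr => e e0.
    have [[U [oU AU] Ue] _] := H A e mA e0.
    have mU := open_borel oU.
    apply: (@le_trans _ _ (abs_charge mu U)).
      by apply: ereal_inf_lbound; exists U.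
    by rewrite !abs_chargeE// -EFinD lee_fin (diff _ _ mA mU AU) lerD2l ltW.
  + apply/lee_addgt0Pr => e e0.
    have [_ [C [cC CA] Ce]] := H A e mA e0.
    have mC := compact_borel cC.
    apply: (@le_trans _ _ (abs_charge mu C + e%:E)%E).
      by rewrite !abs_chargeE// -EFinD lee_fin (diff _ _ mC mA CA) lerD2l ltW.
    by rewrite leeD2r//; apply: ereal_sup_ubound; exists C.
  + apply: ge_ereal_sup => _ [C [cC CA] <-]; apply: le_mu => //.
    exact: compact_borel.
Qed.

(** The open and compact sets that approximate [A] for [mu] up to [e / c] do so for
    [nu] up to [e].  This is what makes the perturbations of [mu] regular. *)
Lemma regular_dominated mu nu (c : R) : regular_charge mu -> 0 < c ->
  (forall B, measurable B -> `|cval nu B| <= c * tvar mu B) ->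
  regular_charge nu.
Proof.
move=> /regular_chargeP rmu c0 /tvar_dominated numu.
apply/regular_chargeP => A e mA e0.
have [[U [oU AU] Ue] [C [cC CA] Ce]] := rmu A (e / c) mA (divr_gt0 e0 c0).
have [mU mC] := (open_borel oU, compact_borel cC).
rewrite ltr_pdivlMr// mulrC in Ue; rewrite ltr_pdivlMr// mulrC in Ce.
split; [exists U => //; apply: le_lt_trans Ue|exists C => //; apply: le_lt_trans Ce].
- by apply: numu; exact: measurableD.
- by apply: numu; exact: measurableD.
Qed.

Lemma cval_delta (t : K) (A : set (borelType K)) : cval (delta R t) A = \1_A t.
Proof. by []. Qed.

Lemma tvar_delta (t : K) (A : set (borelType K)) : measurable A ->
  tvar (delta R t) A = \1_A t.
Proof.
move=> mA; rewrite (@tvarE _ _ _ _ setT set0)//.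
  by rewrite setIT setI0 cval0 subr0 cval_delta.
split; rewrite ?setU0 ?setI0//; last exact: negative_set0.
Qed.

Lemma regular_delta (t : K) : regular_charge (delta R t).
Proof.
apply/regular_chargeP => A e mA e0.
have small (B : set (borelType K)) : measurable B -> ~ B t ->
    tvar (delta R t) B < e.
  by move=> mB Bt; rewrite tvar_delta// indicE memNset.
have [At|At] := pselect (A t); split.
- exists setT; first by split=> //; exact: openT.
  by apply: small => [|[]//]; exact: measurableD.
- exists [set t]; first by split; [exact: compact_set1|move=> _ ->].
  by apply: small => [|[_]]; [exact: measurableD (borel1 _)|exact].
- exists (~` [set t]); first split.
  + by apply: closed_openC; exact: closed1.
  + by move=> x Ax xt; apply: At; rewrite -xt.
  + apply: small => [|[+ _]]; last exact.
    by apply: measurableD => //; apply: measurableC; exact: borel1.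
- exists set0; first by split; [exact: compact0|].
  by apply: small => [|[]//]; exact: measurableD.
Qed.

End regularity.

(** * Perturbations of an extreme point *)

Section extreme_points.
Context (R : realType) (K : ptopologicalType).
Hypothesis hK : hausdorff_space K.
Implicit Types (mu nu h : signed_measure K R).
Implicit Types (A B P N : set (borelType K)).

Local Notation extreme := (extreme_point (unit_ball0 (K:=K) (R:=R))).

(** Replaces extended-real identities between charges, and equality of charges up
    to non-measurable sets, by identities between real numbers. *)
Lemma extreme_pointP mu :
  extreme mu <->
  [/\ regular_charge mu,
      forall A, measurable A -> `|cval mu A| <= 1 &
      forall nu1 nu2 (r : R),
        regular_charge nu1 -> (forall A, measurable A -> `|cval nu1 A| <= 1) ->
        regular_charge nu2 -> (forall A, measurable A -> `|cval nu2 A| <= 1) ->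
        0 < r < 1 ->
        (forall A, measurable A ->
           cval mu A = r * cval nu1 A + (1 - r) * cval nu2 A) ->
        forall A, measurable A -> cval nu1 A = cval mu A /\ cval nu2 A = cval mu A].
Proof.
split=> [[[rmu /norm0_le1P mu1] H]|[rmu mu1 H]].
- split=> // nu1 nu2 r rnu1 /norm0_le1P nu11 rnu2 /norm0_le1P nu21 r01 e A mA.
  have ce : charge_eq mu (cadd (cscale r nu1) (cscale (1 - r) nu2)).
    by apply/charge_eqP => B mB; rewrite cval_add// !cval_scale// e.
  have [/charge_eqP e1 /charge_eqP e2] :=
    H nu1 nu2 r (conj rnu1 nu11) (conj rnu2 nu21) r01 ce.
  by rewrite e1// e2.
- split; first by split=> //; exact/norm0_le1P.
  move=> nu1 nu2 r [rnu1 /norm0_le1P nu11] [rnu2 /norm0_le1P nu21] r01.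
  move=> /charge_eqP e.
  have {}H := H nu1 nu2 r rnu1 nu11 rnu2 nu21 r01.
  have {H}H A : measurable A -> cval nu1 A = cval mu A /\ cval nu2 A = cval mu A.
    by apply: H => B mB; rewrite e// cval_add// !cval_scale.
  by split; apply/charge_eqP => A /H[].
Qed.

Lemma regular_opp mu : regular_charge mu -> regular_charge (copp mu).
Proof.
move=> rmu; apply: (regular_dominated hK rmu ltr01) => B mB.
by rewrite mul1r cval_opp normrN cval_le_tvar.
Qed.

(** The ball is symmetric.  The hypothesis is on values only, so that the lemma
    applies with [mu] and [nu] exchanged. *)
Lemma extreme_opp mu nu : (forall A, measurable A -> cval nu A = - cval mu A) ->
  extreme mu -> extreme nu.
Proof.
move=> e /extreme_pointP[rmu mu1 H]; apply/extreme_pointP; split.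
- apply: (regular_dominated hK rmu ltr01) => B mB.
  by rewrite mul1r e// normrN cval_le_tvar.
- by move=> A mA; rewrite e// normrN mu1.
- move=> nu1 nu2 r rnu1 nu11 rnu2 nu21 r01 er A mA.
  have [||||B mB|] := H (copp nu1) (copp nu2) r _ _ _ _ r01 _ A mA.
  + exact: regular_opp.
  + by move=> B mB; rewrite cval_opp normrN nu11.
  + exact: regular_opp.
  + by move=> B mB; rewrite cval_opp normrN nu21.
  + by have := er B mB; rewrite e// !cval_opp; lra.
  + by rewrite !cval_opp e//; lra.
Qed.

(** [mu] is the midpoint of [mu + h] and [mu - h]; the domination hypothesis on
    [h] is what makes these two charges regular. *)
Lemma extreme_perturbation mu h (c : R) : extreme mu -> 0 <= c ->
  (forall B, measurable B -> `|cval h B| <= c * tvar mu B) ->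
  (forall B, measurable B -> `|cval mu B + cval h B| <= 1) ->
  (forall B, measurable B -> `|cval mu B - cval h B| <= 1) ->
  forall B, measurable B -> cval h B = 0.
Proof.
move=> /extreme_pointP[rmu mu1 H] c0 hc hD hB B mB.
have c1 : 0 < 1 + c by rewrite ltr_pwDl.
pose nu1 : signed_measure K R := cadd mu h.
pose nu2 : signed_measure K R := cadd mu (copp h).
have nu1E A : measurable A -> cval nu1 A = cval mu A + cval h A.
  exact: cval_add.
have nu2E A : measurable A -> cval nu2 A = cval mu A - cval h A.
  by move=> mA; rewrite cval_add// cval_opp.
suff [+ _] : cval nu1 B = cval mu B /\ cval nu2 B = cval mu B.
  by rewrite nu1E//; lra.
apply: (H nu1 nu2 2^-1) => //.
- apply: (regular_dominated hK rmu c1) => A mA; rewrite nu1E// mulrDl mul1r.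
  by rewrite (le_trans (ler_normD _ _))// lerD// ?cval_le_tvar ?hc.
- by move=> A mA; rewrite nu1E// hD.
- apply: (regular_dominated hK rmu c1) => A mA; rewrite nu2E// mulrDl mul1r.
  by rewrite (le_trans (ler_normB _ _))// lerD// ?cval_le_tvar ?hc.
- by move=> A mA; rewrite nu2E// hB.
- by lra.
- by move=> A mA; rewrite nu1E// nu2E//; lra.
Qed.

(** The perturbation multiplies [mu] by [1 + a] or [1 - a] on [A], by [1 + b] or
    [1 - b] on [P \ A], and keeps it on [N].  As the factors are nonnegative,
    [(P, N)] remains a Hahn decomposition, so only the new masses of [P] have to
    be bounded. *)
Lemma extreme_split mu P N A (a b : R) : extreme mu ->
  hahn_decomposition mu P N -> measurable A -> A `<=` P ->
  `|a| <= 1 -> `|b| <= 1 ->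
  (1 + a) * cval mu A + (1 + b) * cval mu (P `\` A) <= 1 ->
  (1 - a) * cval mu A + (1 - b) * cval mu (P `\` A) <= 1 ->
  a * cval mu A = 0 /\ b * cval mu (P `\` A) = 0.
Proof.
move=> emu hPN mA AP; have [[mP _] [mN _] PN PN0] := hPN.
have [rmu mu1 _] := (extreme_pointP mu).1 emu.
rewrite !ler_norml => /andP[a1 a2] /andP[b1 b2] hD hB.
have mD : measurable (P `\` A) by exact: measurableD.
pose h : signed_measure K R := cadd (cscale a (crestr mu mA))
                                    (cscale b (crestr mu mD)).
have hE B : measurable B ->
    cval h B = a * cval mu (B `&` A) + b * cval mu (B `&` (P `\` A)).
  by move=> mB; rewrite cval_add// !cval_scale// !cval_restr.
have muE B : measurable B -> [/\ cval mu B = cval mu (B `&` A) +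
    cval mu (B `&` (P `\` A)) + cval mu (B `&` N),
    0 <= cval mu (B `&` A) <= cval mu A,
    0 <= cval mu (B `&` (P `\` A)) <= cval mu (P `\` A) &
    -1 <= cval mu (B `&` N) <= 0].
  move=> mB.
  have mBI C : measurable C -> measurable (B `&` C) by exact: measurableI.
  have le_mu C : measurable C -> C `<=` P ->
      0 <= cval mu (B `&` C) <= cval mu C.
    move=> mC CP; rewrite (cval_pos hPN) /=; [|exact: mBI|by move=> x [_ /CP]].
    rewrite (cvalDI mu mC mB) (setIC C) lerDl (cval_pos hPN)//.
      exact: measurableD.
    by move=> x [/CP].
  split.
  - rewrite (cval_hahn hPN mB) (cvalDI mu (mBI _ mP) mA); congr (cval mu _ + cval mu _ + _).
      by rewrite -setIA (setIidr AP).
    by rewrite setIDA.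
  - exact: le_mu.
  - by apply: le_mu => //; exact: subDsetl.
  - have := mu1 _ (mBI _ mN); rewrite ler_norml => /andP[-> _] /=.
    by rewrite (cval_neg hPN)//; exact: mBI.
have h0 : forall B, measurable B -> cval h B = 0.
  apply: (extreme_perturbation (c := 1) emu) => // B mB;
      have [eB /andP[x1 x2] /andP[y1 y2] /andP[z1 z2]] := muE B mB;
      rewrite hE// ?mul1r ler_norml.
  - have : cval mu (B `&` P) <= tvar mu B by exact: cval_pos_le_tvar hPN mB.
    rewrite (cvalDI mu (measurableI _ _ mB mP) mA) -setIA (setIidr AP) -setIDA.
    by move=> ?; apply/andP; split; nra.
  - by rewrite eB; apply/andP; split; nra.
  - by rewrite eB; apply/andP; split; nra.
have := h0 _ mA; have := h0 _ mD; rewrite !hE// !setIid.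
by rewrite setDIK setIC setDIK !cval0 !mulr0 addr0 add0r.
Qed.

(** * The Jordan parts of an extreme point are zero or Dirac *)

(** If the mass [p] of [P] were strictly between 0 and 1, it could be scaled by
    [1 + (1 - p)] and by [1 - (1 - p)]: [p (2 - p) <= 1]. *)
Lemma extreme_pos_mass mu P N : extreme mu -> hahn_decomposition mu P N ->
  cval mu P = 0 \/ cval mu P = 1.
Proof.
move=> emu hPN; have [[mP _] [mN _] PN PN0] := hPN.
have [rmu mu1 _] := (extreme_pointP mu).1 emu.
have p0 : 0 <= cval mu P by exact: cval_pos hPN _ _ _.
have := mu1 _ mP; rewrite ler_norml => /andP[_ p1].
have : `|1 - cval mu P| <= 1 by rewrite ler_norml; apply/andP; split; lra.
move=> c1.
have [|| + _] := extreme_split emu hPN mP (@subset_refl _ P) c1 c1.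
- by rewrite setDv cval0; nra.
- by rewrite setDv cval0; nra.
by move=> /eqP; rewrite mulf_eq0 subr_eq0 => /orP[/eqP|/eqP]; [right|left].
Qed.

(** Mass can be moved between the part of [P] in [A] and the rest of [P]: with
    [a] and [b] their masses, scaling by [1 + b] on the first and by [1 - a] on
    the second keeps the total [a + b]. *)
Lemma extreme_zero_one mu P N : extreme mu -> hahn_decomposition mu P N ->
  cval mu P = 1 ->
  forall A, measurable A -> cval mu (A `&` P) = 0 \/ cval mu (A `&` P) = 1.
Proof.
move=> emu hPN p1 A mA; have [[mP _] _ _ _] := hPN.
have mAP : measurable (A `&` P) by exact: measurableI.
have AP : A `&` P `<=` P by exact: subIsetr.
have a0 := cval_pos hPN mAP AP.
have b0 := cval_pos hPN (measurableD mP mAP) (@subDsetl _ _ _).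
have := cvalDI mu mP mAP; rewrite (setIidr AP) p1 => ab.
have [||||ba _] := @extreme_split _ _ _ _ (cval mu (P `\` (A `&` P)))
  (- cval mu (A `&` P)) emu hPN mAP AP.
- by rewrite ler_norml; apply/andP; split; lra.
- by rewrite ler_norml; apply/andP; split; lra.
- by nra.
- by nra.
move: ba => /eqP; rewrite mulf_eq0 => /orP[/eqP b|/eqP]; [right; lra|by left].
Qed.

(** The Borel sets of full mass generate a proper filter, since two of them
    cannot be disjoint; by inner regularity of [P] it contains a compact set [C],
    hence has a cluster point [s] in [C].  If [s] were not an atom, outer
    regularity would give an open neighbourhood of mass less than 1, hence of
    mass 0, whose complement would be in the filter. *)
Lemma zero_one_dirac mu P N : regular_charge mu -> hahn_decomposition mu P N ->
  cval mu P = 1 ->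
  (forall A, measurable A -> cval mu (A `&` P) = 0 \/ cval mu (A `&` P) = 1) ->
  exists2 s : K, P s & forall A, measurable A -> cval mu (A `&` P) = \1_A s.
Proof.
move=> rmu hPN p1 H01; have [[mP _] [mN _] PN PN0] := hPN.
have reg := (regular_chargeP hK mu).1 rmu.
(* the positive part of mu *)
pose m : signed_measure K R := crestr mu mP.
have m0 A : measurable A -> 0 <= cval m A.
  move=> mA; apply: (cval_pos hPN); first exact: measurableI.
  exact: subIsetr.
have m01 A : measurable A -> cval m A = 0 \/ cval m A = 1 by exact: H01.
have mT : cval m setT = 1 by rewrite cval_restr setTI.
(* a set of small variation is null, as m is at most the variation *)
have m_small A : measurable A -> tvar mu A < 1 -> cval m A = 0.
  move=> mA A1; have [//|e] := m01 A mA.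
  by have := cval_pos_le_tvar hPN mA; rewrite -[cval mu _]/(cval m A) e; lra.
have mC A : measurable A -> cval m A + cval m (~` A) = 1.
  by move=> mA; rewrite -mT [RHS](cvalDI m measurableT mA) setTI setTD.
pose F : set_system K := [set S : set K | exists B : set (borelType K),
  [/\ measurable B, B `<=` S & cval m B = 1]].
have FF : ProperFilter F.
  split; first by case=> B [_]; rewrite subset0 => ->; rewrite cval0; lra.
  split.
  - by exists setT.
  - move=> S1 S2 [B1 [mB1 BS1 B11]] [B2 [mB2 BS2 B21]].
    exists (B1 `&` B2); split; [exact: measurableI|exact: setISS|].
    have [B0|//] := m01 _ (measurableI _ _ mB1 mB2).
    have := cvalDI m mB1 mB2; have := cvalDI m mB2 (measurableC mB1).
    rewrite setDE setCK (setIC B2 B1) -setDE => e1 e2.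
    have := mC _ mB1; have := cvalDI m (measurableC mB1) mB2.
    have := m0 _ (measurableD (measurableC mB1) mB2).
    by rewrite (setIC (~` B1)) -setDE; lra.
  - by move=> S1 S2 S12 [B [mB BS1 B1]]; exists B; split=> // x /BS1/S12.
have [_ [C [cC CP] PC]] := reg P 1 mP ltr01.
have mCK := compact_borel hK cC.
have FC : F C.
  exists C; split=> //; have [C0|//] := m01 _ mCK.
  have := m_small _ (measurableD mP mCK) PC.
  have := cvalDI m mP mCK; rewrite (setIidr CP) C0 cval_restr setIid.
  lra.
have [s [Cs Fs]] := cC F FF FC.
have ms := borel1 hK s; have Ps := CP _ Cs.
have s1 : cval m [set s] = 1.
  have [s0|//] := m01 _ ms.
  have [[U [oU sU] Us] _] := reg [set s] 1 ms ltr01.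
  have mU := open_borel oU.
  have U0 : cval m U = 0.
    rewrite (cvalDI m mU ms) (setIidr sU) s0 m_small ?addr0//.
    exact: measurableD.
  have FU : F (~` U).
    exists (~` U); split=> //; first exact: measurableC.
    by have := mC _ mU; lra.
  have nU : nbhs s U by apply: open_nbhs_nbhs; split=> //; exact: sU.
  by have [x [+ Ux]] := Fs _ _ FU nU; case.
exists s => // A mA; rewrite -[cval mu _]/(cval m A).
have mAs : measurable (A `\ s) by exact: measurableD.
rewrite (cval_split1 m ms mA) s1 mulr1.
suff -> : cval m (A `\ s) = 0 by rewrite addr0.
have [//|e] := m01 _ mAs.
have := mC _ ms; rewrite s1 (cvalDI m (measurableC ms) mAs).
have -> : ~` [set s] `&` (A `\ s) = A `\ s by apply/setIidr => x [].
have := m0 _ (measurableD (measurableC ms) mAs); rewrite e; lra.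
Qed.

(** The positive half of the classification; applied to [copp mu] it is the
    negative half. *)
Lemma extreme_pos_part mu P N : extreme mu -> hahn_decomposition mu P N ->
  (forall A, measurable A -> cval mu (A `&` P) = 0) \/
  exists2 s : K, P s & forall A, measurable A -> cval mu (A `&` P) = \1_A s.
Proof.
move=> emu hPN; have [[mP _] _ _ _] := hPN.
have [rmu mu1 _] := (extreme_pointP mu).1 emu.
have [p0|p1] := extreme_pos_mass emu hPN; [left=> A mA|right].
- have a0 := cval_pos hPN (measurableI _ _ mA mP) (@subIsetr _ _ _).
  have b0 := cval_pos hPN (measurableD mP mA) (@subDsetl _ _ _).
  by have := cvalDI mu mP mA; rewrite p0 (setIC P); lra.
- exact: zero_one_dirac rmu hPN p1 (extreme_zero_one emu hPN p1).
Qed.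

Lemma zero_not_extreme mu : (forall A, measurable A -> cval mu A = 0) ->
  ~ extreme mu.
Proof.
move=> mu0 /extreme_pointP[_ _ H]; pose t : K := point.
have d1 A : `|cval (delta R t) A| <= 1.
  by rewrite cval_delta indicE ger0_norm// lern1 leq_b1.
have [|||||A mA|+ _] := H (delta R t) (copp (delta R t)) 2^-1 _ _ _ _ _ _ _
  (measurableT : measurable [set: borelType K]).
- exact: regular_delta.
- by move=> A _; exact: d1.
- exact/regular_opp/regular_delta.
- by move=> A _; rewrite cval_opp normrN; exact: d1.
- by lra.
- by rewrite mu0// cval_opp; lra.
- by rewrite mu0// cval_delta indicE in_setT /=; lra.
Qed.

(** * Dirac measures and their differences are extreme *)

(** 1 is an extreme point of the half-line of numbers at most 1. *)
Lemma convex_comb1 (x y r : R) : x <= 1 -> y <= 1 -> 0 < r < 1 ->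
  1 = r * x + (1 - r) * y -> x = 1 /\ y = 1.
Proof.
move=> x1 y1 /andP[r0 r1] e.
have u0 : 0 <= r * (1 - x) by rewrite mulr_ge0 ?subr_ge0// ltW.
have v0 : 0 <= (1 - r) * (1 - y) by rewrite mulr_ge0 ?subr_ge0// ltW.
have u : r * (1 - x) = 0 by lra.
have v : (1 - r) * (1 - y) = 0 by lra.
move/eqP: u; rewrite mulf_eq0 gt_eqF//= => /eqP; move/eqP: v.
rewrite mulf_eq0 subr_eq0 gt_eqF//= => /eqP; lra.
Qed.

(** Adding to the atom a set of positive mass would exceed the bound 1. *)
Lemma full_atom_le0 nu (s : K) A :
  (forall A, measurable A -> `|cval nu A| <= 1) -> cval nu [set s] = 1 ->
  measurable A -> ~ A s -> cval nu A <= 0.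
Proof.
move=> nu1 nus mA As; have ms := borel1 hK s.
have := nu1 _ (measurableU _ _ mA ms); rewrite cvalU//; last first.
  by apply/disjoints_subset => x Ax /= xs; apply: As; rewrite -xs.
by rewrite nus ler_norml => /andP[_]; lra.
Qed.

Lemma extreme_dirac mu (t : K) : regular_charge mu ->
  (forall A, measurable A -> cval mu A = \1_A t) -> extreme mu.
Proof.
move=> rmu muE; have mt := borel1 hK t.
have mut : cval mu [set t] = 1 by rewrite muE// indicE mem_set.
apply/extreme_pointP; split=> //.
  by move=> A mA; rewrite muE// indicE ger0_norm// lern1 leq_b1.
move=> nu1 nu2 r _ nu11 _ nu21 r01 e.
have le1 (nu : signed_measure K R) A :
    (forall A, measurable A -> `|cval nu A| <= 1) -> measurable A ->
    cval nu A <= 1.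
  by move=> nu_1 mA; rewrite (le_trans (ler_norm _)) ?nu_1.
have [nu1t nu2t] : cval nu1 [set t] = 1 /\ cval nu2 [set t] = 1.
  by apply: convex_comb1 r01 _; [exact: le1|exact: le1|rewrite -e].
move=> A mA; have mAt : measurable (A `\ t) by exact: measurableD.
have nAt : ~ (A `\ t) t by case=> _; exact.
have := full_atom_le0 nu11 nu1t mAt nAt.
have := full_atom_le0 nu21 nu2t mAt nAt.
have : cval mu (A `\ t) = 0 by rewrite muE// indicE memNset.
rewrite e// !(cval_split1 _ mt mA) mut nu1t nu2t e//.
move: r01 => /andP[r0 r1] e0 y0 x0.
have : r * cval nu1 (A `\ t) <= 0 by rewrite mulr_ge0_le0// ltW.
have : (1 - r) * cval nu2 (A `\ t) <= 0 by rewrite mulr_ge0_le0// subr_ge0 ltW.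
move=> y1 x1.
have : r * cval nu1 (A `\ t) = 0 by lra.
have : (1 - r) * cval nu2 (A `\ t) = 0 by lra.
move=> /eqP; rewrite mulf_eq0 subr_eq0 gt_eqF//= => /eqP ->.
move=> /eqP; rewrite mulf_eq0 gt_eqF//= => /eqP ->.
by split; lra.
Qed.

Lemma extreme_dirac_sub mu (s t : K) : s <> t -> regular_charge mu ->
  (forall A, measurable A -> cval mu A = \1_A s - \1_A t) -> extreme mu.
Proof.
move=> st rmu muE; have ms := borel1 hK s; have mt := borel1 hK t.
have mus : cval mu [set s] = 1.
  by rewrite muE// !indicE mem_set// memNset ?subr0// => /= /esym.
have mut : cval mu [set t] = -1.
  by rewrite muE// !indicE memNset// mem_set// sub0r.
have mu1 A : measurable A -> `|cval mu A| <= 1.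
  by move=> mA; rewrite muE// !indicE; do 2 case: (_ \in A);
     rewrite /= ler_norml; apply/andP; split; lra.
(* the two atoms squeeze the mass of every set missing them to 0 *)
have rigid (nu : signed_measure K R) :
    (forall A, measurable A -> `|cval nu A| <= 1) ->
    cval nu [set s] = 1 -> cval nu [set t] = -1 ->
    forall A, measurable A -> cval nu A = \1_A s - \1_A t.
  move=> nu1 nus nut A mA.
  have mAs : measurable (A `\ s) by exact: measurableD.
  have mAst : measurable ((A `\ s) `\ t) by exact: measurableD.
  have le0 : cval nu ((A `\ s) `\ t) <= 0.
    by apply: (full_atom_le0 nu1 nus) => // -[[_ +] _]; exact.
  have ge0 : cval (copp nu) ((A `\ s) `\ t) <= 0.
    apply: (@full_atom_le0 _ t) => //.
    - by move=> B mB; rewrite cval_opp normrN nu1.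
    - by rewrite cval_opp nut opprK.
    - by move=> [_ +]; exact.
  rewrite cval_opp in ge0.
  rewrite (cval_split1 _ ms mA) (cval_split1 _ mt mAs) nus nut.
  have -> : \1_(A `\ s) t = \1_A t :> R.
    have [At|At] := pselect (A t).
      by rewrite !indicE !mem_set//; split=> // /esym.
    by rewrite !indicE !memNset// => -[].
  by lra.
apply/extreme_pointP; split=> // nu1 nu2 r _ nu11 _ nu21 r01 e.
have bd (nu : signed_measure K R) A :
    (forall A, measurable A -> `|cval nu A| <= 1) -> measurable A ->
    cval nu A <= 1 /\ - cval nu A <= 1.
  by move=> nu_1 /nu_1; rewrite ler_norml => /andP[]; lra.
have [nu1s nu2s] : cval nu1 [set s] = 1 /\ cval nu2 [set s] = 1.
  apply: convex_comb1 r01 _; [by have [] := bd nu1 _ nu11 ms|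
    by have [] := bd nu2 _ nu21 ms|by rewrite -e].
have [nu1t nu2t] : - cval nu1 [set t] = 1 /\ - cval nu2 [set t] = 1.
  apply: convex_comb1 r01 _; [by have [] := bd nu1 _ nu11 mt|
    by have [] := bd nu2 _ nu21 mt|].
  by have := e _ mt; rewrite mut; lra.
move=> A mA; rewrite muE//; split; apply: rigid => //; lra.
Qed.

End extreme_points.

Theorem theorem7 (R : realType) (K : ptopologicalType)
    (cK : compact [set: K]) (hK : hausdorff_space K)
    (mu : signed_measure K R) (rmu : regular_charge mu) :
  extreme_point (unit_ball0 (K:=K) (R:=R)) mu <->
    (exists t : K,
       charge_eq mu (delta R t) \/ charge_eq mu (copp (delta R t))) \/
    (exists s t : K,
       s <> t /\ charge_eq mu (cadd (delta R s) (copp (delta R t)))).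
Proof.
split=> [emu|[[t [/charge_eqP e|/charge_eqP e]]|[s [t [st /charge_eqP e]]]]].
- have hPN := hahn_pairP mu; set P := (hahn_pair mu).1 in hPN.
  set N := (hahn_pair mu).2 in hPN.
  have muE A (mA : measurable A) := cval_hahn hPN mA.
  have eomu : extreme_point (unit_ball0 (K:=K) (R:=R)) (copp mu).
    by apply: (extreme_opp hK _ emu) => A _; rewrite cval_opp.
  have [p0|[s Ps ps]] := extreme_pos_part hK emu hPN;
  have [n0|[t Nt nt]] := extreme_pos_part hK eomu (hahn_opp hPN).
  + exfalso; apply: (zero_not_extreme hK _ emu) => A mA.
    by have := n0 A mA; rewrite cval_opp (muE A mA) p0//; lra.
  + left; exists t; right; apply/charge_eqP => A mA.
    by have := nt A mA; rewrite !cval_opp cval_delta (muE A mA) p0//; lra.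
  + left; exists s; left; apply/charge_eqP => A mA.
    by have := n0 A mA; rewrite cval_opp cval_delta (muE A mA) ps//; lra.
  + right; exists s, t; split.
      move=> st; have [_ _ _ PN0] := hPN.
      by have : (P `&` N) s; [split=> //; rewrite st|rewrite PN0].
    apply/charge_eqP => A mA; have := nt A mA.
    by rewrite cval_add// !cval_opp !cval_delta (muE A mA) ps//; lra.
- by apply: (extreme_dirac hK (t := t) rmu) => A mA; rewrite e// cval_delta.
- apply: (@extreme_opp _ _ hK (copp mu)).
    by move=> A mA; rewrite cval_opp opprK.
  apply: (extreme_dirac hK (t := t)); first exact: regular_opp.
  by move=> A mA; rewrite cval_opp e// cval_opp opprK cval_delta.
- apply: (extreme_dirac_sub hK st rmu) => A mA.
  by rewrite e// cval_add// cval_opp !cval_delta.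
Qed.
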